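(* Let $\phi\in C\ell_{1,3}^+$ be the Dirac-Hestenes spinor $$\phi=\operatorname{Re}X^0\,I+\operatorname{Re}X^1\,\Gamma_{01}+\operatorname{Re}X^2\,\Gamma_{02}+\operatorname{Re}X^3\,\Gamma_{03}+\operatorname{Im}X^3\,\Gamma_{12}+\operatorname{Im}X^2\,\Gamma_{31}+\operatorname{Im}X^1\,\Gamma_{23}+\operatorname{Im}X^0\,\Gamma_{0123},$$ and let $e_{41}=\frac12(1+\Gamma_0)\,\frac12(1+i\Gamma_{12})$, a primitive idempotent of the Dirac algebra $\mathbb{C}_4$. Under the action of the antiautomorphism $\mathcal{A}\mapsto\widetilde{\mathcal{A}^\star}$ of the space-time algebra $C\ell_{1,3}$, the Dirac spinor $$\Phi=\phi e_{41}=\begin{pmatrix}\phi_1&0&0&0\\ \phi_2&0&0&0\\ \phi_3&0&0&0\\ \phi_4&0&0&0\end{pmatrix},$$ an element of a minimal left ideal of the Dirac algebra $C\ell_{4,1}=\mathbb{C}_4\cong M_4(\mathbb{C})$, is transferred into an element of a minimal right ideal (a charge conjugated spinor) $$\widetilde{\Phi^\star}=\widetilde{e_{41}^\star}\,\widetilde{\phi^\star}=\begin{pmatrix}0&0&0&0\\0&0&0&0\\0&0&0&0\\-\phi_4&\phi_3&-\phi_2&\phi_1\end{pmatrix}$$ of the same algebra. Here $$\phi_1=\operatorname{Re}X^0-i\operatorname{Im}X^3,\quad \phi_2=\operatorname{Im}X^2-i\operatorname{Im}X^1,\quad \phi_3=\operatorname{Re}X^3-i\operatorname{Im}X^0,\quad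 \phi_4=\operatorname{Re}X^1+i\operatorname{Re}X^2,$$ where $$X^1=\frac{i}{2}\int_\Gamma(\psi_1\psi_2\,d\bar z-\varphi_1\varphi_2\,dz),\qquad X^2=\frac12\int_\Gamma(\psi_1\psi_2\,d\bar z+\varphi_1\varphi_2\,dz),$$ $$X^3=\frac12\int_\Gamma(\psi_1\varphi_2\,d\bar z-\varphi_1\psi_2\,dz),\qquad X^0=\frac{i}{2}\int_\Gamma(\psi_1\varphi_2\,d\bar z+\varphi_1\psi_2\,dz)$$ are the generalized Weierstrass formulae for conformal immersion of a surface into $\mathbb{C}^4$, the complex-valued functions $\psi_\alpha,\varphi_\alpha$ of $(z,\bar z)$ being solutions of the linear system $$\partial_z\psi_\alpha=p\,\varphi_\alpha,\qquad \partial_{\bar z}\varphi_\alpha=q\,\psi_\alpha,\qquad \alpha=1,2,$$ with complex-valued functions $p,q$.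
   Context: Weierstrass data: $\Gamma$ is a contour in the complex plane $\mathbb{C}$ with coordinate $z$, and the functions $X^i(z,\bar z)$, $i=0,1,2,3$, are interpreted as the coordinates in $\mathbb{C}^4$ of a surface. The surface is conformally immersed in the sense that its induced metric is proportional to $dz\,d\bar z$. The linear system for $\psi_\alpha,\varphi_\alpha$ is the Davey-Stewartson II linear problem. The space-time algebra $C\ell_{1,3}$ is the real Clifford algebra of signature $(1,3)$, realized as the real subalgebra of $M_4(\mathbb{C})$ generated by $$\Gamma_0=\begin{pmatrix}1&0&0&0\\0&1&0&0\\0&0&-1&0\\0&0&0&-1\end{pmatrix},\quad \Gamma_1=\begin{pmatrix}0&0&0&1\\0&0&1&0\\0&-1&0&0\\-1&0&0&0\end{pmatrix},$$ $$\Gamma_2=\begin{pmatrix}0&0&0&-i\\0&0&i&0\\0&i&0&0\\-i&0&0&0\end{pmatrix},\quad \Gamma_3=\begin{pmatrix}0&0&1&0\\0&0&0&-1\\-1&0&0&0\\0&1&0&0\end{pmatrix}.$$ Products are written $\Gamma_{i_1\cdots i_k}=\Gamma_{i_1}\cdots\Gamma_{i_k}$; $I$ is the identity matrix. $C\ell_{1,3}^+$ is the subalgebra of even elements; its elements are called Dirac-Hestenes spinors. The Dirac algebra is the complexification $\mathbb{C}_4=\mathbb{C}\otimes C\ell_{1,3}$, identified (via the matrices above) with $M_4(\mathbb{C})$ and also with the real Clifford algebra $C\ell_{4,1}$. The antiautomorphism $\mathcal{A}\mapsto\widetilde{\mathcal{A}^\star}$ is the composition of the grade involution $\mathcal{A}\mapsto\mathcal{A}^\star$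 (multiplying homogeneous elements of degree $k$ by $(-1)^k$) and the reversion $\mathcal{A}\mapsto\widetilde{\mathcal{A}}$ (the antiautomorphism sending $\Gamma_{i_1 i_2\cdots i_k}$ to $\Gamma_{i_k\cdots i_2 i_1}$); on homogeneous elements of degree $k$ it is multiplication by $(-1)^{k(k+1)/2}$. In matrix form it is $A\mapsto (CE^T)A^T(CE^T)^{-1}$ with $C=\Gamma_{13}$ and $E=\Gamma_{0123}$, and in this form it acts complex-linearly on $M_4(\mathbb{C})$. An idempotent $e$ is primitive if it is nonzero and is not a sum $f+g$ of two nonzero idempotents with $fg=gf=0$. A minimal left (right) ideal of an algebra $A$ here is one of the form $Ae$ (respectively $eA$) with $e$ a primitive idempotent. *)

(* Defs.v *)
(* The complex field is R[i] over an arbitrary R : realType. *)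
From HB Require Import structures.
From mathcomp Require Import all_boot all_order all_algebra.
From mathcomp Require Import complex.
From mathcomp Require Import all_classical all_reals all_analysis.
Set Implicit Arguments.
Unset Strict Implicit.
Unset Printing Implicit Defensive.
Import Order.TTheory GRing.Theory Num.Theory.
Import numFieldNormedType.Exports.
(* complex.Re and complex.Im, not those of Num.Theory *)
Import complex.
Local Open Scope classical_set_scope.
Local Open Scope ring_scope.
Local Open Scope complex_scope.

Section Clifford.
Variable R : realType.
Local Notation C := R[i].
Local Notation M4 := 'M[C]_4.

Definition mx4 (rows : seq (seq C)) : M4 :=
  \matrix_(i, j) (nth [::] rows i)`_j.

Definition Gamma (k : 'I_4) : M4 :=
  nth 0 [:: mx4 [:: [:: 1; 0; 0; 0]; [:: 0; 1; 0; 0];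
                    [:: 0; 0; -1; 0]; [:: 0; 0; 0; -1]];
            mx4 [:: [:: 0; 0; 0; 1]; [:: 0; 0; 1; 0];
                    [:: 0; -1; 0; 0]; [:: -1; 0; 0; 0]];
            mx4 [:: [:: 0; 0; 0; -'i%C]; [:: 0; 0; 'i%C; 0];
                    [:: 0; 'i%C; 0; 0]; [:: -'i%C; 0; 0; 0]];
            mx4 [:: [:: 0; 0; 1; 0]; [:: 0; 0; 0; -1];
                    [:: -1; 0; 0; 0]; [:: 0; 1; 0; 0]]] k.

(* Gam [:: i1; ...; ik] is the product Gamma_{i1...ik}; the indices are
   elements of 'I_4, so the numerals 0, 1, 2, 3 may be used for them. *)
Definition Gam (s : seq 'I_4) : M4 := \prod_(k <- s) Gamma k.

(* The space-time algebra: the real subalgebra generated by the Gamma k. *)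
Inductive Cl13 : M4 -> Prop :=
| Cl13_one : Cl13 1
| Cl13_gen k : Cl13 (Gamma k)
| Cl13_add A B : Cl13 A -> Cl13 B -> Cl13 (A + B)
| Cl13_mul A B : Cl13 A -> Cl13 B -> Cl13 (A * B)
| Cl13_scale (r : R) A : Cl13 A -> Cl13 (r%:C *: A).

(* enum S is increasing, so the blade of S is Gamma_{i1...ik} with
   i1 < ... < ik the elements of S; the 16 blades are a basis of the Dirac
   algebra M_4(C) over C, and of Cl13 over the reals. *)
Definition blade (S : {set 'I_4}) : M4 := Gam (enum S).

Definition blades : #|{: {set 'I_4}}|.-tuple M4 :=
  [tuple blade (enum_val k) | k < #|{: {set 'I_4}}|].

Definition blade_coef (S : {set 'I_4}) (A : M4) : C :=
  coord blades (enum_rank S) A.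

Definition grade_part (k : nat) (A : M4) : M4 :=
  \sum_(S : {set 'I_4} | #|S| == k) blade_coef S A *: blade S.

Definition Cl13_even (A : M4) : Prop :=
  Cl13 A /\ A = \sum_(k < 5 | ~~ odd k) grade_part k A.

Definition grade_involution (A : M4) : M4 :=
  \sum_(k < 5) (-1) ^+ k *: grade_part k A.

Definition reversion (A : M4) : M4 :=
  \sum_(S : {set 'I_4}) blade_coef S A *: Gam (rev (enum S)).

Definition tilde_star (A : M4) : M4 := reversion (grade_involution A).

Definition antiautomorphism (f : M4 -> M4) : Prop :=
  [/\ linear f, bijective f & forall A B, f (A * B) = f B * f A].

Definition primitive_idempotent (e : M4) : Prop :=
  [/\ e * e = e, e != 0 &
      forall f g : M4, f * f = f -> g * g = g -> f != 0 -> g != 0 ->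
        f * g = 0 -> g * f = 0 -> e <> f + g].

Definition left_ideal (e : M4) : set M4 := [set A | exists B, A = B * e].
Definition right_ideal (e : M4) : set M4 := [set A | exists B, A = e * B].

Definition minimal_left_ideal (J : set M4) : Prop :=
  exists2 e, primitive_idempotent e & J = left_ideal e.
Definition minimal_right_ideal (J : set M4) : Prop :=
  exists2 e, primitive_idempotent e & J = right_ideal e.

Definition dirac_hestenes (X : 'I_4 -> C) : M4 :=
  (Re (X 0))%:C *: 1
  + (Re (X 1))%:C *: Gam [:: 0; 1]
  + (Re (X 2))%:C *: Gam [:: 0; 2]
  + (Re (X 3))%:C *: Gam [:: 0; 3]
  + (Im (X 3))%:C *: Gam [:: 1; 2]
  + (Im (X 2))%:C *: Gam [:: 3; 1]
  + (Im (X 1))%:C *: Gam [:: 2; 3]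
  + (Im (X 0))%:C *: Gam [:: 0; 1; 2; 3].

Definition e41 : M4 :=
  (2^-1 *: (1 + Gam [:: 0])) * (2^-1 *: (1 + 'i%C *: Gam [:: 1; 2])).

End Clifford.

Section Plane.
Variable R : realType.
Local Notation C := R[i].

(* R[i] carries no topology of its own: openness and real differentiability
   are those of the plane R * R, with z = x + iy read as (x, y). *)
Definition on_plane (T : Type) (f : C -> T) : R * R -> T :=
  fun w => f (w.1 +i* w.2).

Definition plane_open (D : set C) : Prop := open (on_plane D : set (R * R)).

Definition real_differentiable (f : C -> C) (z : C) : Prop :=
  differentiable (on_plane (fun w => Re (f w))) (Re z, Im z) /\
  differentiable (on_plane (fun w => Im (f w))) (Re z, Im z).

(* The value on the tangent vector v of the real differential of f at z. *)
Definition real_differential (f : C -> C) (z v : C) : C :=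
  'D_(Re v, Im v) (on_plane (fun w => Re (f w))) (Re z, Im z) +i*
  'D_(Re v, Im v) (on_plane (fun w => Im (f w))) (Re z, Im z).

(* Wirtinger derivatives: real_differential f z 1 and real_differential f z 'i
   are the partial derivatives of f with respect to x and y. *)
Definition d_z (f : C -> C) (z : C) : C :=
  (real_differential f z 1 - 'i%C * real_differential f z 'i%C) / 2.
Definition d_zbar (f : C -> C) (z : C) : C :=
  (real_differential f z 1 + 'i%C * real_differential f z 'i%C) / 2.

Definition dsII_solution (D : set C) (p q psi varphi : C -> C) : Prop :=
  forall z, D z ->
    [/\ real_differentiable psi z, real_differentiable varphi z,
        d_z psi z = p z * varphi z & d_zbar varphi z = q z * psi z].

Definition C1 (f : R -> R) : Prop :=
  (forall t, derivable f t 1) /\ continuous (derive1 f).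

(* A C^1 arc on a closed interval is the restriction of a C^1 map on R. *)
Definition piecewise_C1 (g : R -> C) (a b : R) : Prop :=
  exists n (tau : nat -> R),
    [/\ tau 0 = a, tau n = b &
        forall k, (k < n)%N -> tau k < tau k.+1 /\
          exists eta : R -> C,
            [/\ C1 (fun t => Re (eta t)), C1 (fun t => Im (eta t)) &
                forall t, tau k <= t <= tau k.+1 -> g t = eta t]].

Record contour := Contour {
  cpath : R -> C;
  cfrom : R;
  cto : R;
  cpathP : piecewise_C1 cpath cfrom cto }.

Definition contour_in (D : set C) (G : contour) : Prop :=
  forall t, cfrom G <= t <= cto G -> D (cpath G t).

(* Its value at the finitely many corners of G is irrelevant below. *)
Definition velocity (G : contour) (t : R) : C :=
  derive1 (fun s => Re (cpath G s)) t +i*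
  derive1 (fun s => Im (cpath G s)) t.

(* The integral over G of  f dz + g dzbar. *)
Definition contour_integral (G : contour) (f g : C -> C) : C :=
  let h t := f (cpath G t) * velocity G t + g (cpath G t) * (velocity G t)^*%C in
  (\int[lebesgue_measure]_(t in `[cfrom G, cto G]) Re (h t))%R +i*
  (\int[lebesgue_measure]_(t in `[cfrom G, cto G]) Im (h t))%R.

Definition weierstrass (psi1 psi2 varphi1 varphi2 : C -> C) (G : contour)
    (k : 'I_4) : C :=
  let int_ := contour_integral G in
  nth 0 [:: 'i%C / 2 * int_ (fun z => varphi1 z * psi2 z)
                          (fun z => psi1 z * varphi2 z);
            'i%C / 2 * int_ (fun z => - (varphi1 z * varphi2 z))
                          (fun z => psi1 z * psi2 z);
            1 / 2 * int_ (fun z => varphi1 z * varphi2 z)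
                         (fun z => psi1 z * psi2 z);
            1 / 2 * int_ (fun z => - (varphi1 z * psi2 z))
                         (fun z => psi1 z * varphi2 z)] k.

(* Y : D -> C^4 is a surface given by the Weierstrass formulae: its coordinates
   increase along each contour by the values of the integrals. *)
Definition weierstrass_surface (D : set C) (psi1 psi2 varphi1 varphi2 : C -> C)
    (Y : 'I_4 -> C -> C) : Prop :=
  forall G k, contour_in D G ->
    Y k (cpath G (cto G)) - Y k (cpath G (cfrom G)) =
    weierstrass psi1 psi2 varphi1 varphi2 G k.

(* Both metrics that C^4 induces, the Hermitian sum |dY^k|^2 and the complex
   bilinear sum (dY^k)^2, are functions of z times dz dzbar. *)
Definition conformally_immersed (D : set C) (Y : 'I_4 -> C -> C) : Prop :=
  [/\ forall k z, D z -> real_differentiable (Y k) z,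
      exists lambda : C -> R, forall z v, D z ->
        \sum_(k < 4) real_differential (Y k) z v *
                     (real_differential (Y k) z v)^*%C =
        (lambda z)%:C * (v * v^*%C)
    & exists mu : C -> C, forall z v, D z ->
        \sum_(k < 4) real_differential (Y k) z v ^+ 2 = mu z * (v * v^*%C)].

End Plane.

(* Main.v *)
Require Import Defs.
From HB Require Import structures.
From mathcomp Require Import all_boot all_order all_algebra.
From mathcomp Require Import complex ring.
From mathcomp Require Import all_classical all_reals all_analysis.
Set Implicit Arguments.
Unset Strict Implicit.
Unset Printing Implicit Defensive.
Import Order.TTheory GRing.Theory Num.Theory.
Import numFieldNormedType.Exports.
Import complex.
Local Open Scope classical_set_scope.
Local Open Scope ring_scope.
Local Open Scope complex_scope.

(**
The theorem has an algebraic half, about the Dirac algebra, and an analytic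
half, about the surface.

Algebra. Everything reduces to the closed form
  tilde_star A = Gamma_02 * A^T * Gamma_02        (tilde_starE).
The right-hand side is visibly linear, involutive and multiplication-reversing,
since Gamma_02 is antisymmetric and squares to 1. It sends Gamma_k to - Gamma_k:
Gamma_0 and Gamma_2 are symmetric and anticommute with Gamma_02, Gamma_1 and
Gamma_3 are antisymmetric and commute with it. Hence it sends a product
Gamma_{i1...ik} to (-1)^k Gamma_{ik...i1}, which is what reversion composed with
the grade involution does on blades. As tilde_star is defined by coordinates on
the blades, the comparison needs that the 16 blades are a basis of M_4(C)
(span_blades, free_blades). They span: by the Clifford relations every product
of generators is plus or minus a blade (Gam_blade), so that their span is stable
under left multiplication by the generators and under transposition; it contains
e41, which is the matrix unit E_00, the products of generators move E_00 to all
E_i0 up to sign (delta_col0), and transposition and left multiplication then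
give all E_ij. Being 16 in number, they are free.

The rest of the algebra is then a calculation with one column: phi * e41 is
the first column of phi, and tilde_star maps a first column to a last row
(tilde_star_mx_col0), in particular e41 = E_00 to E_33. The matrix units E_ii
are primitive because E_ii A E_ii is a multiple of E_ii (primitive_delta).

Analysis. A surface whose increments along contours are integrals of
f dz + g dzbar has this form as its real differential, by integration over short
segments (contour_primitive); f and g are continuous because the psi_a and
varphi_a are differentiable. With the four differentials of the Weierstrass
formulae, the bilinear sum of the squares vanishes because
(psi_1 psi_2)(varphi_1 varphi_2) = (psi_1 varphi_2)(varphi_1 psi_2), and in the
Hermitian sum the cross terms cancel by the parallelogram law, which leaves
half the sum of the squared moduli of these four products times |dz|^2.
*)

(** * Matrices given by rows *)

(* Clears the zeros, units and signs that products of sparse rows leave. *)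
Ltac mx4_simpl := rewrite ?(mulr0, mul0r, addr0, add0r, mulr1, mul1r, mulrN,
  mulNr, opprK, oppr0, mulrN1, mulN1r).

Section Rows.
Variable R : realType.
Local Notation C := R[i].
Local Notation M4 := 'M[C]_4.

(** The operations on rows let a product of explicit matrices be evaluated once,
    as a list of lists, instead of separately for each pair of indices. *)
Definition rows_mul (a b : seq (seq C)) : seq (seq C) :=
  mkseq (fun i => mkseq (fun j =>
    (nth [::] a i)`_0 * (nth [::] b 0)`_j +
    (nth [::] a i)`_1 * (nth [::] b 1)`_j +
    (nth [::] a i)`_2 * (nth [::] b 2)`_j +
    (nth [::] a i)`_3 * (nth [::] b 3)`_j) 4) 4.

Definition rows_add (a b : seq (seq C)) : seq (seq C) :=
  mkseq (fun i => mkseq (fun j =>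
    (nth [::] a i)`_j + (nth [::] b i)`_j) 4) 4.

Definition rows_tr (a : seq (seq C)) : seq (seq C) :=
  mkseq (fun i => mkseq (fun j => (nth [::] a j)`_i) 4) 4.

Lemma mx4_mul a b : mx4 a * mx4 b = mx4 (rows_mul a b).
Proof.
apply/matrixP => i j; rewrite !mxE !big_ord_recl big_ord0 addr0 !addrA !mxE.
by rewrite /rows_mul !nth_mkseq.
Qed.

Lemma mx4_add a b : mx4 a + mx4 b = mx4 (rows_add a b).
Proof. by apply/matrixP => i j; rewrite !mxE !nth_mkseq. Qed.

Lemma mx4_tr a : (mx4 a)^T = mx4 (rows_tr a).
Proof. by apply/matrixP => i j; rewrite !mxE !nth_mkseq. Qed.

Lemma mx4_map (f : C -> C) (a : seq (seq C)) :
  f 0 = 0 -> map_mx f (mx4 a) = mx4 (map (map f) a).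
Proof.
(* mx4 pads missing entries with 0, which f must preserve. *)
move=> f0; apply/matrixP => i j; rewrite !mxE.
have [lt_i|ge_i] := ltnP i (size a); last first.
  by rewrite !(nth_default _ ge_i) !nth_default ?size_map ?f0.
rewrite (nth_map [::]) //; have [lt_j|ge_j] := ltnP j (size (nth [::] a i)).
  by rewrite (nth_map 0).
by rewrite !(@nth_default _ (0 : C)) ?size_map ?f0.
Qed.

Lemma mx4_opp (a : seq (seq C)) : - mx4 a = mx4 (map (map -%R) a).
Proof. by rewrite -mx4_map ?oppr0 //; apply/matrixP => i j; rewrite !mxE. Qed.

Lemma mx4_scale (c : C) a : c *: mx4 a = mx4 (map (map ( *%R c)) a).
Proof. by rewrite -mx4_map ?mulr0 //; apply/matrixP => i j; rewrite !mxE. Qed.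

Lemma ord4P (P : 'I_4 -> Prop) : P 0 -> P 1 -> P 2 -> P 3 -> forall k, P k.
Proof.
move=> P0 P1 P2 P3 [[|[|[|[|//]]]] lt_k];
  [move: P0|move: P1|move: P2|move: P3]; congr P; exact: val_inj.
Qed.

Lemma sum_ord4 (F : 'I_4 -> C) : \sum_(k < 4) F k = F 0 + F 1 + F 2 + F 3.
Proof.
rewrite !big_ord_recl big_ord0 addr0 !addrA.
by do !congr (_ + _); congr F; apply: val_inj.
Qed.

Lemma mx4_one : 1 = mx4 [:: [:: 1; 0; 0; 0]; [:: 0; 1; 0; 0];
                            [:: 0; 0; 1; 0]; [:: 0; 0; 0; 1]] :> M4.
Proof. by apply/matrixP; elim/ord4P; elim/ord4P; rewrite !mxE. Qed.

Lemma mul_ii : 'i%C * 'i%C = -1 :> C.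
Proof. by rewrite -expr2 sqr_i. Qed.

Lemma trM4 (A B : M4) : (A * B)^T = B^T * A^T :> M4.
Proof. exact: trmx_mul. Qed.

(** A spinor, that is an element of the minimal left ideal of E_00. *)
Definition col0 (a b c d : C) : M4 :=
  mx4 [:: [:: a; 0; 0; 0]; [:: b; 0; 0; 0]; [:: c; 0; 0; 0]; [:: d; 0; 0; 0]].

Lemma col0_scale x a b c d :
  x *: col0 a b c d = col0 (x * a) (x * b) (x * c) (x * d).
Proof. by rewrite mx4_scale /= !mulr0. Qed.

Lemma col0_add a b c d a' b' c' d' :
  col0 a b c d + col0 a' b' c' d' = col0 (a + a') (b + b') (c + c') (d + d').
Proof. by rewrite mx4_add /rows_add /mkseq /= !addr0. Qed.

End Rows.

(** * The Clifford relations *)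

Section Relations.
Variable R : realType.
Local Notation C := R[i].
Local Notation M4 := 'M[C]_4.
Implicit Types (k l : 'I_4) (s : seq 'I_4).

Lemma Gamma_anticomm k l :
  k != l -> Gamma R k * Gamma R l = - (Gamma R l * Gamma R k).
Proof.
wlog lt_kl : k l / (k < l)%N.
  move=> IH ne_kl; case: (ltngtP k l) => [|lt_lk|/val_inj eq_kl].
  - by move/IH; apply.
  - by rewrite (IH l k) ?opprK // eq_sym.
  by rewrite eq_kl eqxx in ne_kl.
move: lt_kl; elim/ord4P: k; elim/ord4P: l => //= _ _.
all: rewrite /Gamma /= !mx4_mul mx4_opp /rows_mul /mkseq /=; mx4_simpl.
all: by [].
Qed.

Lemma Gamma_sqr k : Gamma R k * Gamma R k = (-1) ^+ (k != 0) *: 1.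
Proof.
elim/ord4P: k; rewrite mx4_one mx4_scale.
all: rewrite /Gamma /= !mx4_mul /rows_mul /mkseq /= ?expr0 ?expr1; mx4_simpl.
all: rewrite ?mul_ii ?opprK; by [].
Qed.

Lemma Gamma_tr k : (Gamma R k)^T = (-1) ^+ odd k *: Gamma R k.
Proof.
elim/ord4P: k; rewrite /Gamma /= mx4_tr mx4_scale /rows_tr /mkseq /=;
  rewrite ?expr0 ?expr1; mx4_simpl.
all: by [].
Qed.

Lemma Gam_nil : Gam R [::] = 1.
Proof. by rewrite /Gam big_nil. Qed.

Lemma Gam_cons k s : Gam R (k :: s) = Gamma R k * Gam R s.
Proof. by rewrite /Gam big_cons. Qed.

Lemma Gam_rcons s k : Gam R (rcons s k) = Gam R s * Gamma R k.
Proof. by rewrite -cats1 /Gam big_cat big_seq1. Qed.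

Definition GamE := (Gam_cons, Gam_nil, mulr1).

Lemma Gamma0_col0 a b c d : Gamma R 0 * col0 a b c d = col0 a b (- c) (- d).
Proof. by rewrite /Gamma /= mx4_mul /rows_mul /mkseq /=; mx4_simpl. Qed.

Lemma Gamma1_col0 a b c d : Gamma R 1 * col0 a b c d = col0 d c (- b) (- a).
Proof. by rewrite /Gamma /= mx4_mul /rows_mul /mkseq /=; mx4_simpl. Qed.

Lemma Gamma2_col0 a b c d : Gamma R 2 * col0 a b c d =
  col0 (- ('i%C * d)) ('i%C * c) ('i%C * b) (- ('i%C * a)).
Proof. by rewrite /Gamma /= mx4_mul /rows_mul /mkseq /=; mx4_simpl. Qed.

Lemma Gamma3_col0 a b c d : Gamma R 3 * col0 a b c d = col0 c (- d) (- a) b.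
Proof. by rewrite /Gamma /= mx4_mul /rows_mul /mkseq /=; mx4_simpl. Qed.

Definition Gamma_col0 := (Gamma0_col0, Gamma1_col0, Gamma2_col0, Gamma3_col0).

Lemma e41_col0 : e41 R = col0 1 0 0 0.
Proof.
rewrite /e41 !GamE -scalerAl -scalerAr scalerA.
rewrite {2}/Gamma /= {2}/Gamma /= {1}/Gamma /= mx4_one mx4_mul !mx4_scale.
rewrite !mx4_add mx4_mul mx4_scale /rows_add /rows_mul /mkseq /=; mx4_simpl.
rewrite mul_ii; mx4_simpl.
have two : 1 + 1 = 2 :> C by [].
by rewrite !subrr; mx4_simpl; rewrite two mulrA divfK ?mulVf ?pnatr_eq0.
Qed.

Lemma e41_delta : e41 R = delta_mx 0 0.
Proof.
by rewrite e41_col0; apply/matrixP; elim/ord4P; elim/ord4P; rewrite !mxE.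
Qed.

End Relations.

(** * The antiautomorphism in matrix form *)

Section MatrixForm.
Variable R : realType.
Local Notation C := R[i].
Local Notation M4 := 'M[C]_4.
Implicit Types (A B : M4) (k : 'I_4) (s : seq 'I_4).

(** In the notation C = Gamma_13, E = Gamma_0123, this is the matrix C E^T,
    because E^T = Gamma_3210 and Gamma_133210 = Gamma_02. It is locked so that
    associativity does not split it into its factors. *)
Definition Gamma02 : M4 := locked (Gamma R 0 * Gamma R 2).

Lemma Gamma02E : Gamma02 = Gamma R 0 * Gamma R 2.
Proof. by rewrite /Gamma02 -lock. Qed.

Lemma Gamma02_sqr : Gamma02 * Gamma02 = 1.
Proof.
rewrite {1}Gamma02E Gamma_anticomm // mulNr Gamma02E -mulrA.
rewrite (mulrA (Gamma R 0)) Gamma_sqr eqxx expr0 scale1r mul1r.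
by rewrite Gamma_sqr /= expr1 scaleN1r opprK.
Qed.

Lemma Gamma02_tr : Gamma02^T = - Gamma02.
Proof. by rewrite Gamma02E trM4 !Gamma_tr !expr0 !scale1r Gamma_anticomm. Qed.

Lemma Gamma02_comm k :
  Gamma02 * Gamma R k = (-1) ^+ (~~ odd k) * (Gamma R k * Gamma02).
Proof.
rewrite Gamma02E; case: (eqVneq k 2) => [->|ne_k2].
  by rewrite expr1 mulN1r mulrA (@Gamma_anticomm _ 2 0) // mulNr opprK.
rewrite -mulrA (@Gamma_anticomm _ 2 k) 1?eq_sym // mulrN.
rewrite (mulrA (Gamma R 0) (Gamma R k)).
case: (eqVneq k 0) => [->|ne_k0]; first by rewrite expr1 mulN1r mulrA.
rewrite (@Gamma_anticomm _ 0 k) 1?eq_sym // mulNr opprK mulrA.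
by move: ne_k0 ne_k2; elim/ord4P: k => // _ _; rewrite expr0 mul1r.
Qed.

(** As Gamma02 is its own inverse, this is A |-> (C E^T) A^T (C E^T)^-1. *)
Definition tilde_star_mx A : M4 := Gamma02 * A^T * Gamma02.

Lemma tilde_star_mx_is_linear : linear tilde_star_mx.
Proof.
by move=> c A B; rewrite /tilde_star_mx linearP /= mulrDr mulrDl
  -scalerAr -scalerAl.
Qed.
HB.instance Definition _ :=
  GRing.isLinear.Build C M4 M4 _ tilde_star_mx tilde_star_mx_is_linear.

Lemma tilde_star_mx1 : tilde_star_mx 1 = 1.
Proof. by rewrite /tilde_star_mx trmx1 mulr1 Gamma02_sqr. Qed.

Lemma tilde_star_mxM A B :
  tilde_star_mx (A * B) = tilde_star_mx B * tilde_star_mx A.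
Proof.
rewrite /tilde_star_mx trM4; move: (A^T) (B^T) => a b; rewrite !mulrA.
by rewrite -[_ * Gamma02 * Gamma02]mulrA Gamma02_sqr mulr1.
Qed.

Lemma tilde_star_mxK : involutive tilde_star_mx.
Proof.
move=> A; rewrite /tilde_star_mx !trM4 trmxK Gamma02_tr.
rewrite !(mulrN, mulNr) opprK !mulrA Gamma02_sqr mul1r -mulrA.
by rewrite Gamma02_sqr mulr1.
Qed.

(** The sign of transposition and the sign of commutation with Gamma02 always
    multiply to -1. *)
Lemma tilde_star_mx_Gamma k : tilde_star_mx (Gamma R k) = - Gamma R k.
Proof.
rewrite /tilde_star_mx Gamma_tr -scalerAr -scalerAl Gamma02_comm -!mulrA.
rewrite Gamma02_sqr mulr1 mulr_sign scaler_sign.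
by case: (odd k); rewrite ?opprK.
Qed.

Lemma tilde_star_mx_Gam s :
  tilde_star_mx (Gam R s) = (-1 : C) ^+ size s *: Gam R (rev s).
Proof.
elim: s => [|k s IH]; first by rewrite Gam_nil tilde_star_mx1 expr0 scale1r.
rewrite Gam_cons tilde_star_mxM IH tilde_star_mx_Gamma rev_cons Gam_rcons /=.
by rewrite exprS mulN1r scaleNr mulrN -scalerAl.
Qed.

Lemma tilde_star_mx_col0 a b c d : tilde_star_mx (col0 a b c d) =
  mx4 [:: [:: 0; 0; 0; 0]; [:: 0; 0; 0; 0]; [:: 0; 0; 0; 0];
          [:: - d; c; - b; a]] :> M4.
Proof.
rewrite /tilde_star_mx Gamma02E /Gamma /= mx4_mul /rows_mul /mkseq /=.
mx4_simpl.
rewrite mx4_tr /rows_tr /mkseq /= !mx4_mul /rows_mul /mkseq /=; mx4_simpl.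
have iMi x : 'i%C * x * 'i%C = - x :> C by rewrite mulrAC mul_ii mulN1r.
by rewrite !iMi !opprK.
Qed.

End MatrixForm.

(** * The blades form a basis *)

Section Basis.
Variable R : realType.
Local Notation C := R[i].
Local Notation M4 := 'M[C]_4.
Implicit Types (A B : M4) (k : 'I_4) (s : seq 'I_4) (S T : {set 'I_4}).

(** Gamma_k is moved to its place in the ordered product at the cost of signs;
    there it is inserted, or cancels against the Gamma_k already present, so
    that membership of k is toggled. *)
Lemma Gamma_mul_prod k (r : seq 'I_4) (P : pred 'I_4) : uniq r -> k \in r ->
  exists b : bool, Gamma R k * \prod_(j <- r | P j) Gamma R j =
    (-1) ^+ b * \prod_(j <- r | P j (+) (j == k)) Gamma R j.
Proof.
elim: r => [//|j r IH] /= /andP[j_notin_r uniq_r]; rewrite inE !big_cons.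
case: (eqVneq k j) => [eq_kj | ne_kj] /= => [_ | k_in_r].
  have -> : \prod_(i <- r | P i (+) (i == k)) Gamma R i =
      \prod_(i <- r | P i) Gamma R i.
    rewrite big_seq_cond [RHS]big_seq_cond; apply: eq_bigl => i.
    case: (boolP (i \in r)) => //= i_in_r.
    case: eqVneq => [eq_ik|_]; last by rewrite addbF.
    by rewrite -eq_kj -eq_ik i_in_r in j_notin_r.
  rewrite -eq_kj addbT; case: (P k) => /=.
    exists (k != 0); rewrite mulrA Gamma_sqr -scalerAl mul1r.
    by rewrite scaler_sign mulr_sign.
  by exists false; rewrite expr0 mul1r.
have [b IHb] := IH uniq_r k_in_r; rewrite addbF.
case: (P j); last by exists b.
exists (~~ b); rewrite mulrA Gamma_anticomm // mulNr -mulrA IHb !mulr_sign.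
by case: (b) => //=; rewrite mulrN opprK.
Qed.

Lemma bladeE S : blade R S = \prod_(k in S) Gamma R k.
Proof.
by rewrite /blade /Gam -[RHS]big_filter [index_enum _]unlock.
Qed.

Definition toggle k S : {set 'I_4} := [set j | (j \in S) (+) (j == k)].

Lemma Gamma_mul_blade k S : exists b : bool,
  Gamma R k * blade R S = (-1) ^+ b * blade R (toggle k S).
Proof.
have [b eq_b] := @Gamma_mul_prod k (index_enum _) (fun j => j \in S)
  (index_enum_uniq _) (mem_index_enum _).
exists b; rewrite !bladeE eq_b; congr (_ * _); apply: eq_bigl => j.
by rewrite inE.
Qed.

Lemma odd_toggle k S : odd #|toggle k S| = ~~ odd #|S|.
Proof.
rewrite (cardsD1 k S) (cardsD1 k (toggle k S)) inE eqxx addbT.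
have -> : toggle k S :\ k = S :\ k.
  by apply/setP => j; rewrite !inE; case: (j == k); rewrite ?addbF.
by rewrite !oddD !oddb addNb.
Qed.

(** The parity of the number of factors is recorded because it decides whether
    the product is an even element. *)
Lemma Gam_blade s : exists (b : bool) S,
  odd #|S| = odd (size s) /\ Gam R s = (-1) ^+ b * blade R S.
Proof.
elim: s => [|k s [b [S [odd_S IH]]]].
  exists false, finset.set0; rewrite cards0; split => //.
  by rewrite expr0 mul1r bladeE big_set0 Gam_nil.
have [b' eq_b'] := Gamma_mul_blade k S.
exists (b (+) b'), (toggle k S); split; first by rewrite odd_toggle odd_S.
by rewrite Gam_cons IH mulrA commr_sign -mulrA eq_b' mulrA -signr_addb.
Qed.

Lemma blades_nth (i : 'I_#|{: {set 'I_4}}|) :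
  (blades R)`_i = blade R (enum_val i).
Proof. by rewrite -tnth_nth tnth_mktuple. Qed.

Lemma blades_ind (P : M4 -> Prop) :
    P 0 -> (forall c A B, P A -> P B -> P (c *: A + B)) ->
    (forall S, P (blade R S)) ->
  forall A, A \in <<blades R>>%VS -> P A.
Proof.
move=> P0 PD PB A /coord_span ->.
elim/big_rec: _ => // i B _ PA; apply: PD => //.
by rewrite blades_nth; exact: PB.
Qed.

Lemma span_sign (b : bool) A :
  A \in <<blades R>>%VS -> (-1) ^+ b * A \in <<blades R>>%VS.
Proof. by rewrite mulr_sign; case: b; rewrite ?rpredN. Qed.

Lemma span_Gam s : Gam R s \in <<blades R>>%VS.
Proof.
have [b [S [_ ->]]] := Gam_blade s; apply/span_sign/memv_span.
by rewrite -(enum_rankK S) -blades_nth mem_nth // size_tuple.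
Qed.

Lemma span_Gamma_mul k A :
  A \in <<blades R>>%VS -> Gamma R k * A \in <<blades R>>%VS.
Proof.
move: A; apply: blades_ind => [|c A B VA VB|S].
- by rewrite mulr0 rpred0.
- by rewrite mulrDr -scalerAr rpredD ?rpredZ.
by rewrite /blade -Gam_cons span_Gam.
Qed.

Lemma span_Gam_mul s A :
  A \in <<blades R>>%VS -> Gam R s * A \in <<blades R>>%VS.
Proof.
move=> VA; elim: s => [|k s IH]; first by rewrite Gam_nil mul1r.
by rewrite Gam_cons -mulrA span_Gamma_mul.
Qed.

Lemma Gam_tr s : exists b : bool, (Gam R s)^T = (-1) ^+ b * Gam R (rev s).
Proof.
elim: s => [|k s [b IH]]; first by exists false; rewrite Gam_nil trmx1 mul1r.
exists (b (+) odd k); rewrite Gam_cons trM4 IH Gamma_tr rev_cons Gam_rcons.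
by case: (b); case: (odd k);
  rewrite /= ?expr0 ?expr1 ?scaleN1r ?scale1r ?mulN1r ?mul1r ?(mulrN, mulNr)
    ?opprK.
Qed.

Lemma span_tr A : A \in <<blades R>>%VS -> A^T \in <<blades R>>%VS.
Proof.
move: A; apply: blades_ind => [|c A B VA VB|S].
- by rewrite trmx0 rpred0.
- by rewrite linearP rpredD ?rpredZ.
by have [b ->] := Gam_tr (enum S); apply/span_sign/span_Gam.
Qed.

Lemma span_e41 : e41 R \in <<blades R>>%VS.
Proof.
have span1 : (1 : M4) \in <<blades R>>%VS by rewrite -Gam_nil span_Gam.
rewrite /e41 -scalerAl rpredZ // mulrDl mul1r.
by rewrite rpredD ?span_Gam_mul // rpredZ // rpredD // rpredZ // span_Gam.
Qed.

(** The products 1, Gamma_13, Gamma_3, Gamma_1 move the first basis vector to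
    each of the four basis vectors, up to sign. *)
Lemma delta_col0 i : exists (b : bool) s,
  delta_mx i 0 = (-1) ^+ b * (Gam R s * delta_mx 0 0) :> M4.
Proof.
have delta_colE : delta_mx i 0 =
    col0 (i == 0)%:R (i == 1)%:R (i == 2)%:R (i == 3)%:R :> M4.
  by apply/matrixP; elim/ord4P: i; elim/ord4P; elim/ord4P; rewrite !mxE.
rewrite delta_colE -e41_delta e41_col0; elim/ord4P: i {delta_colE} => /=.
- by exists false, [::]; rewrite Gam_nil !mul1r.
- exists true, [:: 1; 3]; rewrite !GamE -mulrA Gamma3_col0 Gamma1_col0.
  by rewrite expr1 mulN1r -scaleN1r col0_scale; mx4_simpl.
- exists true, [:: 3]; rewrite !GamE Gamma3_col0.
  by rewrite expr1 mulN1r -scaleN1r col0_scale; mx4_simpl.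
exists true, [:: 1]; rewrite !GamE Gamma1_col0.
by rewrite expr1 mulN1r -scaleN1r col0_scale; mx4_simpl.
Qed.

Lemma span_delta i j : delta_mx i j \in <<blades R>>%VS.
Proof.
have [b [s eq_i]] := delta_col0 i.
have [b' [s' eq_j]] := delta_col0 j.
have V0j : (delta_mx 0 j : M4) \in <<blades R>>%VS.
  rewrite -[delta_mx 0 j]trmxK span_tr // trmx_delta eq_j -e41_delta.
  exact/span_sign/span_Gam_mul/span_e41.
have -> : delta_mx i j = (-1) ^+ b * (Gam R s * delta_mx 0 j) :> M4.
  rewrite -(mul_delta_mx (0 : 'I_4) i j) -[_ *m _]/(_ * _) eq_i -!mulrA.
  by congr (_ * (_ * _)); rewrite -[_ * _]/(_ *m _) mul_delta_mx.
exact/span_sign/span_Gam_mul.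
Qed.

Lemma span_blades : (<<blades R>> = fullv)%VS.
Proof.
apply/vspaceP => A; rewrite memvf (matrix_sum_delta A).
apply: rpred_sum => i _; apply: rpred_sum => j _.
by rewrite rpredZ // span_delta.
Qed.

Lemma free_blades : free (blades R).
Proof.
by rewrite /free span_blades dimvf dim_matrix size_tuple -cardsT -powersetT
  card_powerset cardsT card_ord.
Qed.

End Basis.

(** * Grades and the antiautomorphism *)

Section Grades.
Variable R : realType.
Local Notation C := R[i].
Local Notation M4 := 'M[C]_4.
Implicit Types (A B : M4) (s : seq 'I_4) (S T : {set 'I_4}).

Lemma blade_coef_is_linear S : linear (@blade_coef R S).
Proof. by move=> c A B; rewrite /blade_coef linearP. Qed.
HB.instance Definition _ S :=
  GRing.isLinear.Build C M4 C _ (@blade_coef R S) (blade_coef_is_linear S).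

Lemma blade_coef_blade S T : blade_coef S (blade R T) = (T == S)%:R.
Proof.
rewrite /blade_coef -(enum_rankK T) -blades_nth coord_free ?free_blades //.
by rewrite enum_rankK (inj_eq (@enum_rank_inj _)).
Qed.

Lemma eq_linear_blade (V : lmodType C) (f g : {linear M4 -> V}) :
  (forall S, f (blade R S) = g (blade R S)) -> f =1 g.
Proof.
move=> eq_fg A; have : A \in <<blades R>>%VS by rewrite span_blades memvf.
move: A; apply: blades_ind => [|c A B fA fB|//]; first by rewrite !linear0.
by rewrite !linearP fA fB.
Qed.

Lemma grade_part_is_linear (k : nat) : linear (@grade_part R k).
Proof.
move=> c A B; rewrite /grade_part scaler_sumr -big_split /=.
by apply: eq_bigr => S _; rewrite linearP scalerDl scalerA.
Qed.
HB.instance Definition _ (k : nat) :=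
  GRing.isLinear.Build C M4 M4 _ (@grade_part R k) (grade_part_is_linear k).

Lemma grade_part_blade (k : nat) S :
  grade_part k (blade R S) = if #|S| == k then blade R S else 0.
Proof.
rewrite /grade_part; have [cardS | ne_k] := eqVneq #|S| k.
  rewrite (bigD1 S) ?cardS //= blade_coef_blade eqxx scale1r.
  rewrite big1 ?addr0 // => T /andP[_ neTS].
  by rewrite blade_coef_blade eq_sym (negPf neTS) scale0r.
rewrite big1 // => T /eqP cardT; rewrite blade_coef_blade.
case: (eqVneq S T) ne_k => [->|_ _]; last by rewrite scale0r.
by rewrite cardT eqxx.
Qed.

Lemma sum_grade_blade (P : pred nat) (c : nat -> C) S :
  \sum_(k < 5 | P k) c k *: grade_part k (blade R S) =
  if P #|S| then c #|S| *: blade R S else 0.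
Proof.
have lt5 : (#|S| < 5)%N by have := max_card (mem S); rewrite card_ord.
case: ifP => PS.
  rewrite (bigD1 (Ordinal lt5)) //= grade_part_blade eqxx.
  rewrite big1 ?addr0 // => k /andP[_ ne_kS].
  rewrite grade_part_blade eq_sym.
  by rewrite (negPf ne_kS : (_ == _ :> nat) = _) scaler0.
rewrite big1 // => k Pk; rewrite grade_part_blade.
case: eqP => [eq_k|]; last by rewrite scaler0.
by rewrite eq_k Pk in PS.
Qed.

Lemma grade_involution_is_linear : linear (@grade_involution R).
Proof.
move=> c A B; rewrite /grade_involution scaler_sumr -big_split /=.
by apply: eq_bigr => S _; rewrite linearP scalerDr !scalerA mulrC.
Qed.
HB.instance Definition _ := GRing.isLinear.Build C M4 M4 _
  (@grade_involution R) grade_involution_is_linear.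

Lemma reversion_is_linear : linear (@reversion R).
Proof.
move=> c A B; rewrite /reversion scaler_sumr -big_split /=.
by apply: eq_bigr => S _; rewrite linearP scalerDl !scalerA.
Qed.
HB.instance Definition _ :=
  GRing.isLinear.Build C M4 M4 _ (@reversion R) reversion_is_linear.

Lemma reversion_blade S : reversion (blade R S) = Gam R (rev (enum S)).
Proof.
rewrite /reversion (bigD1 S) //= blade_coef_blade eqxx scale1r.
rewrite big1 ?addr0 // => T neTS.
by rewrite blade_coef_blade eq_sym (negPf neTS) scale0r.
Qed.

(** Both sides are linear and send the blade of S to (-1)^|S| times the product
    of its generators in reverse order. *)
Lemma tilde_starE : @tilde_star R = @tilde_star_mx R.
Proof.
apply/funext; apply: (@eq_linear_blade _
  (@reversion R \o @grade_involution R) (@tilde_star_mx R)) => S /=.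
rewrite /grade_involution (sum_grade_blade xpredT) linearZ /= reversion_blade.
by rewrite /blade tilde_star_mx_Gam cardE.
Qed.

Lemma tilde_star_antiautomorphism : antiautomorphism (@tilde_star R).
Proof.
rewrite tilde_starE; split; first exact: tilde_star_mx_is_linear.
  exact: inv_bij (@tilde_star_mxK R).
exact: tilde_star_mxM.
Qed.

Lemma even_part_Gam s : ~~ odd (size s) ->
  \sum_(k < 5 | ~~ odd k) grade_part k (Gam R s) = Gam R s.
Proof.
have [b [S [odd_S ->]]] := Gam_blade R s; rewrite -odd_S => even_S.
transitivity ((-1) ^+ b *:
    \sum_(k < 5 | ~~ odd k) 1 *: grade_part k (blade R S)).
  rewrite scaler_sumr; apply: eq_bigr => k _.
  by rewrite mulr_sign scaler_sign scale1r; case: b; rewrite // linearN.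
rewrite (sum_grade_blade (fun k : nat => ~~ odd k) (fun=> 1)) even_S scale1r.
by rewrite mulr_sign scaler_sign.
Qed.

Lemma Cl13_Gam s : Cl13 (Gam R s).
Proof.
elim: s => [|k s IH]; first by rewrite Gam_nil; exact: Cl13_one.
by rewrite Gam_cons; apply: Cl13_mul => //; exact: Cl13_gen.
Qed.

Lemma Cl13_tilde_star A : Cl13 A -> Cl13 (tilde_star A).
Proof.
rewrite tilde_starE; elim=> [|k|B D _ IHB _ IHD|B D _ IHB _ IHD|r B _ IHB].
- by rewrite tilde_star_mx1; exact: Cl13_one.
- have -> : tilde_star_mx (Gamma R k) = (-1)%:C *: Gamma R k.
    by rewrite tilde_star_mx_Gamma rmorphN1 scaleN1r.
  by apply: Cl13_scale; exact: Cl13_gen.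
- by rewrite linearD; apply: Cl13_add.
- by rewrite tilde_star_mxM; apply: Cl13_mul.
by rewrite linearZ; apply: Cl13_scale.
Qed.

End Grades.

(** * Spinors and minimal ideals *)

Section Spinors.
Variable R : realType.
Local Notation C := R[i].
Local Notation M4 := 'M[C]_4.
Implicit Types (A : M4) (i : 'I_4) (s : seq 'I_4) (X : 'I_4 -> C).

Lemma sandwich_delta i A :
  delta_mx i i * A * delta_mx i i = A i i *: delta_mx i i.
Proof.
apply/matrixP => a b.
rewrite !mxE (bigD1 i) //= !mxE (bigD1 i) //= !mxE !eqxx.
rewrite !big1 => [|j /negPf ne_ji|j /negPf ne_ji]; last 2 first.
- by rewrite !mxE ne_ji mulr0.
- by rewrite !mxE ne_ji andbF mul0r.
rewrite !addr0 andbT mulrC; case: (a == i); case: (b == i);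
  by rewrite ?mul0r ?mulr0 ?mul1r ?mulr1.
Qed.

(** A summand f of e = E_ii satisfies f = e f e, so it is a multiple x e with
    x^2 = x: it is 0, or it is e and leaves 0 for the other summand. *)
Lemma primitive_delta i : primitive_idempotent (delta_mx i i : M4).
Proof.
have ee : delta_mx i i * delta_mx i i = delta_mx i i :> M4.
  exact: mul_delta_mx.
split=> // [|f g ff gg /eqP f_neq0 g_neq0 fg gf e_fg].
  by apply/eqP => /matrixP /(_ i i) /eqP; rewrite !mxE eqxx oner_eq0.
have f_e : f = f i i *: delta_mx i i.
  by rewrite -sandwich_delta e_fg mulrDl gf addr0 ff mulrDr fg addr0 ff.
have : f i i * f i i = f i i.
  have := ff; rewrite {1 2}f_e -scalerAl -scalerAr scalerA ee.
  by move=> /matrixP /(_ i i); rewrite !mxE eqxx mulr1.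
move=> /eqP; rewrite -subr_eq0 -{3}[f i i]mulr1 -mulrBr mulf_eq0 subr_eq0.
case/orP => /eqP fii; first by apply: f_neq0; rewrite f_e fii scale0r.
case/negP: g_neq0; apply/eqP; apply: (addrI f).
by rewrite addr0 -e_fg f_e fii scale1r.
Qed.

Lemma tilde_star_e41 : tilde_star (e41 R) = delta_mx 3 3.
Proof.
rewrite tilde_starE e41_col0 tilde_star_mx_col0 !oppr0.
by apply/matrixP; elim/ord4P; elim/ord4P; rewrite !mxE.
Qed.

Lemma dirac_hestenes_even X : Cl13_even (dirac_hestenes X).
Proof.
split; first by do ![apply: Cl13_add | apply: Cl13_scale | apply: Cl13_Gam
                    | exact: Cl13_one].
have addZ A c s : \sum_(k < 5 | ~~ odd k) grade_part k A = A ->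
    ~~ odd (size s) ->
    \sum_(k < 5 | ~~ odd k) grade_part k (A + c *: Gam R s) = A + c *: Gam R s.
  move=> evA evs; rewrite -[in RHS]evA -[in RHS](even_part_Gam R evs).
  rewrite scaler_sumr -big_split /=.
  by apply: eq_bigr => k _; rewrite linearD linearZ.
(* The scalar term is peeled off last, as the empty product. *)
rewrite /dirac_hestenes -(Gam_nil R); apply/esym.
do 7 (apply: (addZ _); last by []).
rewrite -[in RHS](@even_part_Gam R [::]) // scaler_sumr.
by apply: eq_bigr => k _; exact: linearZ.
Qed.

Lemma dirac_hestenes_mul_e41 X : dirac_hestenes X * e41 R =
  col0 ((Re (X 0))%:C - 'i%C * (Im (X 3))%:C)
       ((Im (X 2))%:C - 'i%C * (Im (X 1))%:C)
       ((Re (X 3))%:C - 'i%C * (Im (X 0))%:C)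
       ((Re (X 1))%:C + 'i%C * (Re (X 2))%:C).
Proof.
rewrite e41_col0 /dirac_hestenes !GamE !mulrDl -!scalerAl mul1r -!mulrA.
rewrite !Gamma_col0 !col0_scale !col0_add.
by congr col0; mx4_simpl; rewrite ?(mulrC 'i%C).
Qed.

End Spinors.

(** * Integrals along short segments *)

Section Segments.
Variable R : realType.
Local Notation C := R[i].
Implicit Types (P Q U F L : R * R -> R) (v w h : R * R).

Definition lform (a b : R) (h : R * R) : R := a * h.1 + b * h.2.

Lemma lform_is_linear a b : linear (lform a b : R * R -> R^o).
Proof. by move=> c u v; rewrite /lform /= /GRing.scale /=; ring. Qed.
HB.instance Definition _ a b := GRing.isLinear.Build R (R * R)%type R^o _
  (lform a b : R * R -> R^o) (lform_is_linear a b).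

Lemma lform_continuous a b : continuous (lform a b).
Proof.
move=> h; apply: cvgD; (apply: cvgM; first exact: cvg_cst).
  exact: cvg_fst.
exact: cvg_snd.
Qed.

Lemma norm_lform a b h : `|lform a b h| <= (`|a| + `|b|) * `|h|.
Proof.
rewrite prod_normE mulrDl /lform (le_trans (ler_normD _ _)) // !normrM.
by rewrite lerD // ler_wpM2l // le_max lexx ?orbT.
Qed.

Definition first_order F L : Prop := forall eps : R, 0 < eps ->
  \forall h \near (0 : R * R), `|F h - L h| <= eps * `|h|.

Lemma first_order_comb F1 L1 F2 L2 (a b : R) :
    first_order F1 L1 -> first_order F2 L2 ->
  first_order (fun h => a * F1 h + b * F2 h) (fun h => a * L1 h + b * L2 h).
Proof.
move=> approx1 approx2 eps eps_gt0.
(* The summand 1 only keeps the denominator positive when a = b = 0. *)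
have M_gt0 : 0 < `|a| + `|b| + 1 by rewrite ltr_wpDl // addr_ge0.
have e_gt0 : 0 < eps / (`|a| + `|b| + 1) by rewrite divr_gt0.
near=> h.
have le1 : `|F1 h - L1 h| <= eps / (`|a| + `|b| + 1) * `|h|.
  by near: h; exact: approx1.
have le2 : `|F2 h - L2 h| <= eps / (`|a| + `|b| + 1) * `|h|.
  by near: h; exact: approx2.
have -> : (a * F1 h + b * F2 h) - (a * L1 h + b * L2 h) =
    a * (F1 h - L1 h) + b * (F2 h - L2 h) by ring.
rewrite (le_trans (ler_normD _ _)) // !normrM.
apply: (@le_trans _ _ ((`|a| + `|b|) * (eps / (`|a| + `|b| + 1) * `|h|))).
  by rewrite mulrDl lerD // ler_wpM2l.
rewrite mulrA ler_wpM2r // mulrCA ler_piMr ?(ltW eps_gt0) //.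
by rewrite ler_pdivrMr // mul1r lerDl.
Unshelve. all: by end_near.
Qed.

Lemma first_order_diff U w (a b : R) :
    first_order (fun h => U (h + w) - U w) (lform a b) ->
  differentiable U w /\ forall v, 'D_v U w = lform a b v.
Proof.
move=> approx.
have U_o : U \o shift w = cst (U w) + lform a b +o_ (0 : R * R) id.
  apply/eqaddoP => eps eps_gt0; near=> h.
  rewrite /= !fctE /= opprD addrA; near: h; exact: approx.
have dU := diff_unique (@lform_continuous a b) U_o.
have diffU : differentiable U w.
  by apply/diff_locallyP; rewrite dU; split => //; exact: lform_continuous.
by split=> // v; rewrite deriveE // dU.
Unshelve. all: by end_near.
Qed.

Lemma segment_near w (A : set (R * R)) : nbhs w A ->
  \forall h \near (0 : R * R),
    forall t : R, `[0, 1]%classic t -> A (t *: h + w).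
Proof.
move=> /nbhs_ballP [delta /= delta_gt0 near_w]; near=> h => t.
rewrite /= in_itv /= => /andP[t_ge0 t_le1]; apply: near_w.
rewrite -ball_normE /ball_ /= opprD addrCA subrr addr0 normrN normrZ.
rewrite (ger0_norm t_ge0).
apply: (@le_lt_trans _ _ `|h|); first by rewrite ler_piMl.
by near: h; exact: (@nbhs0_lt R (R * R)%type).
Unshelve. all: by end_near.
Qed.

(** The integral of the one-form P dx + Q dy along the segment from w to
    w + h. *)
Definition segment_integral P Q w h : R :=
  (\int[lebesgue_measure]_(t in `[0%R, 1%R])
    lform (P (t *: h + w)) (Q (t *: h + w)) h)%R.

(** On a short segment the integrand stays within eps |h| of its value at w.
    Continuity of P and Q on a whole neighbourhood of w, not only at w, is what
    makes it integrable. *)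
Lemma segment_integral_first_order (D : set (R * R)) P Q w :
    open D -> D w ->
    (forall v, D v -> {for v, continuous P}) ->
    (forall v, D v -> {for v, continuous Q}) ->
  first_order (segment_integral P Q w) (lform (P w) (Q w)).
Proof.
move=> openD Dw cP cQ eps eps_gt0.
have e2 : 0 < eps / 2 by rewrite divr_gt0.
have near_w : \forall v \near w,
    D v /\ `|P w - P v| <= eps / 2 /\ `|Q w - Q v| <= eps / 2.
  near=> v; split; first by near: v; exact: open_nbhs_nbhs.
  split; near: v.
    by have /cvgr_dist_le := cP _ Dw; apply.
  by have /cvgr_dist_le := cQ _ Dw; apply.
apply: filterS (segment_near near_w) => h in_seg.
pose phi t := lform (P (t *: h + w)) (Q (t *: h + w)) h.
have phi_close t : `[0, 1]%classic t ->
    `|phi t - lform (P w) (Q w) h| <= eps * `|h|.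
  move=> t01; have [_ [closeP closeQ]] := in_seg _ t01.
  have -> : phi t - lform (P w) (Q w) h =
      - lform (P w - P (t *: h + w)) (Q w - Q (t *: h + w)) h.
    by rewrite /phi /lform; ring.
  rewrite normrN (le_trans (norm_lform _ _ _)) // ler_wpM2r //.
  by rewrite [leRHS]splitr lerD.
have line_cont : continuous (fun t : R => t *: h + w).
  by move=> t; apply: cvgD; [exact: scalel_continuous | exact: cvg_cst].
have phi_int : lebesgue_measure.-integrable `[0, 1] (EFin \o phi).
  apply: continuous_compact_integrable; first exact: segment_compact.
  apply: continuous_in_subspaceT => t; rewrite inE => t01.
  have [Dt _] := in_seg _ t01.
  apply: cvgD; (apply: cvgM; last exact: cvg_cst).
    by apply: (@continuous_comp _ _ _ (fun t : R => t *: h + w) P);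
      [exact: line_cont | exact: cP].
  by apply: (@continuous_comp _ _ _ (fun t : R => t *: h + w) Q);
    [exact: line_cont | exact: cQ].
have cst_int c :
    lebesgue_measure.-integrable `[0, 1] (EFin \o (cst c : R -> R)).
  apply: continuous_compact_integrable; first exact: segment_compact.
  by apply: continuous_subspaceT => t; exact: cvg_cst.
have int_cst (c : R) :
    (\int[lebesgue_measure]_(t in `[0%R, 1%R]) (cst c : R -> R) t)%R = c.
  rewrite Rintegral_cst; last exact: measurable_itv.
  have len1 : lebesgue_measure `[0%R : R, 1%R]%classic = 1%E.
    by rewrite lebesgue_measure_itv /= lte_fin ltr01 -EFinB subr0.
  by rewrite [fine _](congr1 fine len1) mulr1.
rewrite ler_distl; apply/andP; split.
  rewrite -[leLHS]int_cst; apply: le_Rintegral => //.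
  by move=> t /phi_close; rewrite ler_distl => /andP[].
rewrite -[leRHS]int_cst; apply: le_Rintegral => //.
by move=> t /phi_close; rewrite ler_distl => /andP[].
Unshelve. all: by end_near.
Qed.

Definition plane_point (z : C) : R * R := (Re z, Im z).

Definition segment_path w h (t : R) : C := on_plane id (t *: h + w).

Lemma derive1_affine (a b : R) : derive1 (fun t : R => t * a + b) = cst a.
Proof.
apply/funext => t; rewrite derive1E deriveD; last exact: derivable_cst.
  by rewrite derive_cst addr0 deriveMr // derive_id mulr1.
by apply: derivableM; [exact: derivable_id | exact: derivable_cst].
Qed.

Lemma affine_C1 (a b : R) : C1 (fun t : R => t * a + b).
Proof.
split; last by rewrite derive1_affine => t; exact: cvg_cst.
by move=> t; apply: derivableD; [apply: derivableM|exact: derivable_cst].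
Qed.

Lemma segment_path_C1 w h : piecewise_C1 (segment_path w h) 0 1.
Proof.
exists 1%N, (fun k => k%:R); split=> // -[|//] _; split; first exact: ltr01.
by exists (segment_path w h); split=> //; exact: affine_C1.
Qed.

Definition segment w h : contour R := Contour (segment_path_C1 w h).

Lemma segment_velocity w h t : velocity (segment w h) t = h.1 +i* h.2.
Proof. by rewrite /velocity /= !derive1_affine. Qed.

Lemma segment_contour_near (D : set C) z : plane_open D -> D z ->
  \forall h \near (0 : R * R), contour_in D (segment (plane_point z) h).
Proof.
move=> openD Dz.
apply: filterS (segment_near (open_nbhs_nbhs (conj openD _))).
  by move=> h in_D t t01; apply: in_D; rewrite /= in_itv.
by rewrite /on_plane /plane_point /=; case: z Dz.
Qed.

(** The coefficients of the real one-forms that are the real and the imaginary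
    part of f dz + g dzbar. *)
Definition re_form_x (f g : C -> C) := on_plane (fun u => Re (f u) + Re (g u)).
Definition re_form_y (f g : C -> C) := on_plane (fun u => Im (g u) - Im (f u)).
Definition im_form_x (f g : C -> C) := on_plane (fun u => Im (f u) + Im (g u)).
Definition im_form_y (f g : C -> C) := on_plane (fun u => Re (f u) - Re (g u)).

Lemma form_value (f g : C -> C) w h :
  f (on_plane id w) * (h.1 +i* h.2) + g (on_plane id w) * (h.1 +i* h.2)^*%C =
  lform (re_form_x f g w) (re_form_y f g w) h +i*
  lform (im_form_x f g w) (im_form_y f g w) h.
Proof.
rewrite /re_form_x /re_form_y /im_form_x /im_form_y /lform /on_plane /=.
case: (f _) (g _) => [a b] [c d]; simpc => /=.
by congr (_ +i* _); ring.
Qed.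

Lemma segment_contour_integral (f g : C -> C) w h :
  contour_integral (segment w h) f g =
  segment_integral (re_form_x f g) (re_form_y f g) w h +i*
  segment_integral (im_form_x f g) (im_form_y f g) w h.
Proof.
congr (_ +i* _); apply: eq_Rintegral => t _; rewrite segment_velocity.
  exact: (congr1 (@Re R) (form_value f g (t *: h + w) h)).
exact: (congr1 (@Im R) (form_value f g (t *: h + w) h)).
Qed.

Definition plane_continuous (f : C -> C) (z : C) : Prop :=
  {for plane_point z, continuous (on_plane (fun u => Re (f u)))} /\
  {for plane_point z, continuous (on_plane (fun u => Im (f u)))}.

Lemma real_differentiable_continuous (f : C -> C) z :
  real_differentiable f z -> plane_continuous f z.
Proof. by move=> [dR dI]; split; exact: differentiable_continuous. Qed.

Lemma plane_continuousN (f : C -> C) z :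
  plane_continuous f z -> plane_continuous (fun u => - f u) z.
Proof.
have ReN u : Re (- f u) = - Re (f u) by case: (f u).
have ImN u : Im (- f u) = - Im (f u) by case: (f u).
move=> [cR cI]; split.
  rewrite [on_plane _](_ : _ = fun v => - on_plane (fun u => Re (f u)) v).
    exact: cvgN.
  by apply/funext => v; exact: ReN.
rewrite [on_plane _](_ : _ = fun v => - on_plane (fun u => Im (f u)) v).
  exact: cvgN.
by apply/funext => v; exact: ImN.
Qed.

Lemma plane_continuousM (f g : C -> C) z :
    plane_continuous f z -> plane_continuous g z ->
  plane_continuous (fun u => f u * g u) z.
Proof.
have ReM u : Re (f u * g u) = Re (f u) * Re (g u) - Im (f u) * Im (g u).
  by case: (f u) (g u) => [a b] [c d].
have ImM u : Im (f u * g u) = Re (f u) * Im (g u) + Im (f u) * Re (g u).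
  by case: (f u) (g u) => [a b] [c d].
pose r (k : C -> C) := on_plane (fun u => Re (k u)).
pose i (k : C -> C) := on_plane (fun u => Im (k u)).
move=> [fR fI] [gR gI]; split.
  rewrite [on_plane _](_ : _ = fun v => r f v * r g v - i f v * i g v).
    by apply: cvgB; exact: cvgM.
  by apply/funext => v; exact: ReM.
rewrite [on_plane _](_ : _ = fun v => r f v * i g v + i f v * r g v).
  by apply: cvgD; exact: cvgM.
by apply/funext => v; exact: ImM.
Qed.

(** Along segments issuing from z, the increments of y are c times the complex
    number formed by the integrals of two real one-forms, which are known to
    first order; the real and the imaginary part of y follow by real linear
    combination. *)
Lemma contour_primitive (D : set C) (f g y : C -> C) (c : C) :
    plane_open D ->
    (forall z, D z -> plane_continuous f z) ->
    (forall z, D z -> plane_continuous g z) ->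
    (forall G, contour_in D G ->
       y (cpath G (cto G)) - y (cpath G (cfrom G)) =
       c * contour_integral G f g) ->
  forall z, D z -> real_differentiable y z /\
    forall v : C, real_differential y z v = c * (f z * v + g z * v^*%C).
Proof.
move=> openD cf cg inc_y z Dz; set w := plane_point z.
have zE : on_plane id w = z by rewrite /w; case: (z).
have plane_cont v : on_plane D v ->
    [/\ {for v, continuous (re_form_x f g)},
        {for v, continuous (re_form_y f g)},
        {for v, continuous (im_form_x f g)} &
        {for v, continuous (im_form_y f g)}].
  move=> Dv; have [fR fI] := cf _ Dv; have [gR gI] := cg _ Dv.
  have vE : plane_point (v.1 +i* v.2) = v by case: (v).
  rewrite vE in fR fI gR gI.
  by split; [apply: cvgD|apply: cvgB|apply: cvgD|apply: cvgB].
have Dw : on_plane D w by rewrite -zE in Dz.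
pose L1 := lform (re_form_x f g w) (re_form_y f g w).
pose L2 := lform (im_form_x f g w) (im_form_y f g w).
pose I1 := segment_integral (re_form_x f g) (re_form_y f g) w.
pose I2 := segment_integral (im_form_x f g) (im_form_y f g) w.
have approx1 : first_order I1 L1.
  by apply: (segment_integral_first_order openD Dw) => v /plane_cont[].
have approx2 : first_order I2 L2.
  by apply: (segment_integral_first_order openD Dw) => v /plane_cont[].
have inc_near : \forall h \near (0 : R * R),
    y (on_plane id (h + w)) - y z = c * (I1 h +i* I2 h).
  apply: filterS (segment_contour_near openD Dz) => h /inc_y.
  by rewrite segment_contour_integral /= /segment_path scale1r scale0r add0r zE.
have part U (a b : R) :
    (\forall h \near (0 : R * R), U (h + w) - U w = a * I1 h + b * I2 h) ->
  differentiable U w /\ forall v, 'D_v U w = a * L1 v + b * L2 v.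
  move=> inc_U.
  have lin v : a * L1 v + b * L2 v =
      lform (a * re_form_x f g w + b * im_form_x f g w)
            (a * re_form_y f g w + b * im_form_y f g w) v.
    by rewrite /L1 /L2 /lform; ring.
  have [|dU DU] := @first_order_diff U w
    (a * re_form_x f g w + b * im_form_x f g w)
    (a * re_form_y f g w + b * im_form_y f g w).
    move=> eps eps_gt0; near=> h.
    have -> : U (h + w) - U w = a * I1 h + b * I2 h by near: h.
    by rewrite -lin; near: h; exact: first_order_comb.
  by split=> // v; rewrite DU lin.
have [|dR DR] := part (on_plane (fun u => Re (y u))) (Re c) (- Im c).
  apply: filterS inc_near => h; rewrite -zE /on_plane.
  case: (y _) (y _) (c) => [y1 y2] [y3 y4] [c1 c2] [-> _].
  by rewrite mulNr.
have [|dI DI] := part (on_plane (fun u => Im (y u))) (Im c) (Re c).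
  apply: filterS inc_near => h; rewrite -zE /on_plane.
  case: (y _) (y _) (c) => [y1 y2] [y3 y4] [c1 c2] [_ ->].
  by rewrite addrC.
split=> [|v]; first by [].
have -> : v = (plane_point v).1 +i* (plane_point v).2 by case: (v).
rewrite -{2 3}zE form_value -/L1 -/L2 /real_differential.
rewrite -!/(plane_point _) DR DI; case: (c) => c1 c2; rewrite /plane_point /=.
by rewrite mulNr (addrC (c2 * _)).
Unshelve. all: by end_near.
Qed.

End Segments.

(** * Conformality of the Weierstrass immersion *)

Section Conformality.
Variable R : realType.
Local Notation C := R[i].

Definition sqr_modulus (x : C) : R := Re x ^+ 2 + Im x ^+ 2.

Lemma mul_conj (x : C) : x * x^*%C = (sqr_modulus x)%:C.
Proof.
case: x => a b; rewrite /sqr_modulus; simpc.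
by congr (_ +i* _); rewrite /=; ring.
Qed.

(** The parallelogram law, for b v and a w and for d v and c w. *)
Lemma hermitian_sum (a b c d v : C) :
  let w := v^*%C in
  let sq x := x * x^*%C in
  sq ('i%C / 2 * (b * v + a * w)) + sq ('i%C / 2 * (- d * v + c * w)) +
  sq (1 / 2 * (d * v + c * w)) + sq (1 / 2 * (- b * v + a * w)) =
  (sq a + sq b + sq c + sq d) / 2 * sq v.
Proof.
move=> w sq.
have sqM x y : sq (x * y) = sq x * sq y by rewrite /sq rmorphM mulrACA.
have sq_half : sq (1 / 2) = 4^-1.
  by rewrite /sq mul1r fmorphV rmorph_nat -invfM -natrM.
have sq_ihalf : sq ('i%C / 2) = 4^-1.
  have -> : 'i%C / 2 = 'i%C * (1 / 2) :> C by rewrite mul1r.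
  have conj_i : 'i^*%C = - 'i%C :> C.
    by apply/eqP; rewrite eq_complex /= oppr0 !eqxx.
  by rewrite sqM sq_half /sq conj_i mulrN -expr2 sqr_i opprK mul1r.
rewrite !(sqM ('i%C / 2)) !(sqM (1 / 2)) sq_half sq_ihalf /sq /w.
rewrite !(rmorphD, rmorphM, rmorphN) /= conjcK.
by field.
Qed.

(** The terms in v^2 and in w^2 cancel in pairs, and the mixed terms add up to
    v w times (p1 p2) (q1 q2) - (p1 q2) (q1 p2). *)
Lemma bilinear_sum (p1 p2 q1 q2 v w : C) :
  ('i%C / 2 * (q1 * p2 * v + p1 * q2 * w)) ^+ 2 +
  ('i%C / 2 * (- (q1 * q2) * v + p1 * p2 * w)) ^+ 2 +
  (1 / 2 * (q1 * q2 * v + p1 * p2 * w)) ^+ 2 +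
  (1 / 2 * (- (q1 * p2) * v + p1 * q2 * w)) ^+ 2 = 0.
Proof. by rewrite !exprMn sqr_i; ring. Qed.

Lemma weierstrass_conformal (D : set C) (psi1 psi2 phi1 phi2 : C -> C) Y :
    plane_open D ->
    (forall z, D z -> [/\ plane_continuous psi1 z, plane_continuous psi2 z,
       plane_continuous phi1 z & plane_continuous phi2 z]) ->
    weierstrass_surface D psi1 psi2 phi1 phi2 Y ->
  conformally_immersed D Y.
Proof.
move=> openD cont surfY.
have contM (f g : C -> C) : (forall z, D z -> plane_continuous f z) ->
    (forall z, D z -> plane_continuous g z) ->
  forall z, D z -> plane_continuous (fun u => f u * g u) z.
  by move=> cf cg z Dz; apply: plane_continuousM; [exact: cf | exact: cg].
have contN (f : C -> C) : (forall z, D z -> plane_continuous f z) ->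
  forall z, D z -> plane_continuous (fun u => - f u) z.
  by move=> cf z Dz; apply: plane_continuousN; exact: cf.
have cpsi1 z : D z -> plane_continuous psi1 z by move=> /cont[].
have cpsi2 z : D z -> plane_continuous psi2 z by move=> /cont[].
have cphi1 z : D z -> plane_continuous phi1 z by move=> /cont[].
have cphi2 z : D z -> plane_continuous phi2 z by move=> /cont[].
have dY0 := contour_primitive openD
  (contM _ _ cphi1 cpsi2) (contM _ _ cpsi1 cphi2)
  (fun G => @surfY G 0 : _ -> _ = 'i%C / 2 * _).
have dY1 := contour_primitive openD
  (contN _ (contM _ _ cphi1 cphi2)) (contM _ _ cpsi1 cpsi2)
  (fun G => @surfY G 1 : _ -> _ = 'i%C / 2 * _).
have dY2 := contour_primitive openD
  (contM _ _ cphi1 cphi2) (contM _ _ cpsi1 cpsi2)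
  (fun G => @surfY G 2 : _ -> _ = 1 / 2 * _).
have dY3 := contour_primitive openD
  (contN _ (contM _ _ cphi1 cpsi2)) (contM _ _ cpsi1 cphi2)
  (fun G => @surfY G 3 : _ -> _ = 1 / 2 * _).
split.
- by elim/ord4P => z Dz; [exact: (dY0 z Dz).1 | exact: (dY1 z Dz).1
                         | exact: (dY2 z Dz).1 | exact: (dY3 z Dz).1].
- exists (fun z =>
    (sqr_modulus (psi1 z * phi2 z) + sqr_modulus (phi1 z * psi2 z) +
     sqr_modulus (psi1 z * psi2 z) + sqr_modulus (phi1 z * phi2 z)) / 2)
    => z v Dz.
  rewrite sum_ord4 (dY0 z Dz).2 (dY1 z Dz).2 (dY2 z Dz).2 (dY3 z Dz).2.
  by rewrite hermitian_sum !mul_conj rmorphM fmorphV rmorph_nat !rmorphD.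
exists (fun=> 0) => z v Dz; rewrite mul0r sum_ord4.
by rewrite (dY0 z Dz).2 (dY1 z Dz).2 (dY2 z Dz).2 (dY3 z Dz).2 bilinear_sum.
Qed.

End Conformality.

Theorem theorem2 (R : realType) (D : set R[i]) (hD : plane_open D)
    (p q psi1 psi2 varphi1 varphi2 : R[i] -> R[i])
    (h1 : dsII_solution D p q psi1 varphi1)
    (h2 : dsII_solution D p q psi2 varphi2)
    (G : contour R) (hG : contour_in D G) :
  let X := weierstrass psi1 psi2 varphi1 varphi2 G in
  let phi : 'M[R[i]]_4 := dirac_hestenes X in
  let e := e41 R in
  let Phi : 'M[R[i]]_4 := phi * e in
  let phi1 : R[i] := (Re (X 0))%:C - 'i%C * (Im (X 3))%:C in
  let phi2 : R[i] := (Im (X 2))%:C - 'i%C * (Im (X 1))%:C in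
  let phi3 : R[i] := (Re (X 3))%:C - 'i%C * (Im (X 0))%:C in
  let phi4 : R[i] := (Re (X 1))%:C + 'i%C * (Re (X 2))%:C in
  [/\ [/\ antiautomorphism (@tilde_star R),
          (forall k, tilde_star (Gamma R k) = - Gamma R k)
        & (forall A : 'M[R[i]]_4, Cl13 A -> Cl13 (tilde_star A))],
      Cl13_even phi /\ primitive_idempotent e,
      [/\ minimal_left_ideal (left_ideal e), left_ideal e Phi
        & Phi = mx4 [:: [:: phi1; 0; 0; 0];
                        [:: phi2; 0; 0; 0];
                        [:: phi3; 0; 0; 0];
                        [:: phi4; 0; 0; 0]]],
      [/\ minimal_right_ideal (right_ideal (tilde_star e)),
          right_ideal (tilde_star e) (tilde_star Phi),
          tilde_star Phi = tilde_star e * tilde_star phi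
        & tilde_star Phi = mx4 [:: [:: 0; 0; 0; 0];
                                   [:: 0; 0; 0; 0];
                                   [:: 0; 0; 0; 0];
                                   [:: - phi4; phi3; - phi2; phi1]]]
    & (forall Y, weierstrass_surface D psi1 psi2 varphi1 varphi2 Y ->
         conformally_immersed D Y)].
Proof.
move=> X phi e Phi phi1 phi2 phi3 phi4.
have PhiE : Phi = col0 phi1 phi2 phi3 phi4 by exact: dirac_hestenes_mul_e41.
have prim_e : primitive_idempotent e.
  by rewrite /e e41_delta; exact: primitive_delta.
have tildeM : tilde_star Phi = tilde_star e * tilde_star phi.
  by rewrite tilde_starE; exact: tilde_star_mxM.
split.
- split; first exact: tilde_star_antiautomorphism.
    by move=> k; rewrite tilde_starE tilde_star_mx_Gamma.
  exact: Cl13_tilde_star.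
- by split=> //; exact: dirac_hestenes_even.
- by split; [exists e | exists phi | exact: PhiE].
- split=> //.
  + exists (tilde_star e) => //.
    by rewrite tilde_star_e41; exact: primitive_delta.
  + by exists (tilde_star phi).
  + by rewrite PhiE tilde_starE tilde_star_mx_col0.
move=> Y; apply: weierstrass_conformal => // z Dz.
have [dpsi1 dvarphi1 _ _] := h1 z Dz; have [dpsi2 dvarphi2 _ _] := h2 z Dz.
by split; exact: real_differentiable_continuous.
Qed.
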